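(* Let $d\geq 1$ be an integer. There is a constant $c=c(d)$, depending only on $d$, with the following property. Let $F(\mathbf{x})\in\mathbb{Z}[x_1,x_2,x_3]$ be a form of degree $d$ that is irreducible over $\mathbb{Q}$ and whose coefficients are coprime, and let $B\geq 1$. Then either $$N(F;B)\leq d^2\qquad\text{or}\qquad \|F\|\leq c\,B^{d(d+1)(d+2)/2}.$$
   Context: $Z_3$ denotes the set of all nonzero $\mathbf{x}=(x_1,x_2,x_3)\in\mathbb{Z}^3$ with $\gcd(x_1,x_2,x_3)=1$ and such that $x_i>0$ for the smallest index $i$ with $x_i\neq 0$. For $B\geq 1$, $$N(F;B)=\#\{\mathbf{x}\in Z_3:\ F(\mathbf{x})=0,\ \max_{i}|x_i|\leq B\}.$$ $\|F\|$ denotes the maximum modulus of the coefficients of $F$. ''The coefficients are coprime'' means that their overall greatest common divisor is $1$. *)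

(* Defs.v *)
From HB Require Import structures.
From mathcomp Require Import all_boot all_order all_algebra.
From mathcomp Require Import finmap mpoly.
From mathcomp Require Import boolp classical_sets cardinality reals.

Set Implicit Arguments.
Unset Strict Implicit.
Unset Printing Implicit Defensive.

Import Order.TTheory GRing.Theory Num.Theory.

Local Open Scope ring_scope.
Local Open Scope classical_set_scope.

Definition irreducible_elt (A : comUnitRingType) (p : A) : Prop :=
  [/\ p != 0, p \isn't a GRing.unit &
      forall q r : A, p = q * r ->
        q \is a GRing.unit \/ r \is a GRing.unit].

Definition irreducible_over_Q (n : nat) (F : {mpoly int[n]}) : Prop :=
  irreducible_elt (map_mpoly (intr : int -> rat) F).

(* The support [msupp F] lists the monomials with a nonzero coefficient; the
   zero coefficients affect neither a gcd nor a maximum of absolute values. *)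
Definition coef_gcd (n : nat) (F : {mpoly int[n]}) : nat :=
  \big[gcdn/0%N]_(m <- msupp F) `|F@_m|%N.

Definition coef_height (n : nat) (F : {mpoly int[n]}) : nat :=
  (\max_(m <- msupp F) `|F@_m|)%N.

Definition vec_gcd (n : nat) (x : 'rV[int]_n) : nat :=
  \big[gcdn/0%N]_(i < n) `|x ord0 i|%N.

Definition vec_height (n : nat) (x : 'rV[int]_n) : nat :=
  (\max_(i < n) `|x ord0 i|)%N.

Definition first_nonzero_pos (n : nat) (x : 'rV[int]_n) : Prop :=
  exists i : 'I_n,
    0 < x ord0 i /\ forall j : 'I_n, (j < i)%N -> x ord0 j = 0.

Definition Z3 : set 'rV[int]_3 :=
  [set x | [/\ x != 0, vec_gcd x = 1%N & first_nonzero_pos x]].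

Definition zeros (R : realType) (F : {mpoly int[3]}) (B : R) :
    set 'rV[int]_3 :=
  [set x | [/\ Z3 x, F.@[x ord0] = 0 & (vec_height x)%:R <= B]].

(* [fset_set] is empty on infinite sets; this shows that the convention
   plays no role in [Ncount]. *)
Lemma finite_zeros (R : realType) (F : {mpoly int[3]}) (B : R) :
  finite_set (zeros F B).
Proof.
pose M := Num.bound B.
pose f (g : {ffun 'I_3 -> bool * 'I_M.+1}) : 'rV[int]_3 :=
  \row_i ((-1) ^+ (g i).1 * ((g i).2 : nat)%:Z).
apply: (@sub_finite_set _ _ (f @` setT)); last first.
  by apply: finite_image; exact: finite_finset.
move=> x [_ _ hx].
exists [ffun i => (x ord0 i < 0, inord `|x ord0 i|%N)] => //.
apply/rowP => i; rewrite mxE ffunE /= inordK; last first.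
  rewrite ltnS; apply: (@leq_trans (vec_height x)).
    exact: (@leq_bigmax _ (fun i => `|x ord0 i|%N)).
  rewrite -(ler_nat R) (le_trans hx)// ltW// archi_boundP//.
  exact: le_trans (ler0n _ _) hx.
by rewrite -intEsign.
Qed.

Definition Ncount (R : realType) (F : {mpoly int[3]}) (B : R) : nat :=
  #|` fset_set (zeros F B)|%fset.

(* Main.v *)
Require Import Defs.
From HB Require Import structures.
From mathcomp Require Import all_boot all_order all_algebra.
From mathcomp Require Import finmap mpoly.
From mathcomp Require Import boolp classical_sets cardinality reals.
From mathcomp Require Import perm ring zify.

(* Suppose that F has more than d^2 zeros x_i of height at most B, and let
   n = (d+1)(d+2)/2 be the number of monomials of degree d in three variables.
   By Bezout, a form of degree d vanishing at all the x_i is a multiple of F.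
   So the matrix of all monomials at the x_i, with one more row e_k for the
   index k of a largest coefficient f_k of F, has rank n. Choose n independent
   rows A. The coefficient vector f of F satisfies A f = f_k w with w integral,
   hence det(A) f = f_k adj(A) w; as f is primitive, f_k divides det A, and
   |det A| <= n! B^(d n).
   Bezout is proved by counting dimensions of spaces of forms, which needs that
   the irreducible form F is prime. *)

Set Implicit Arguments.
Unset Strict Implicit.
Unset Printing Implicit Defensive.

Import Order.TTheory GRing.Theory Num.Theory.

Local Open Scope ring_scope.

(** * Irreducible and prime elements *)

Definition divides (A : comUnitRingType) (a b : A) : Prop :=
  exists c, b = a * c.

Definition prime_elt (A : comUnitRingType) (p : A) : Prop :=
  [/\ p != 0, p \isn't a GRing.unit &
      forall a b, divides p (a * b) -> divides p a \/ divides p b].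

Definition irreducibles_prime (A : comUnitRingType) : Prop :=
  forall p : A, irreducible_elt p -> prime_elt p.

Definition prime_factorable (A : comUnitRingType) (a : A) : Prop :=
  exists u s, [/\ u \is a GRing.unit, forall p, p \in s -> prime_elt p &
                  a = u * \prod_(p <- s) p].

(** Carries the property across [muni], which singles out the last variable. *)
Lemma irreducibles_prime_iso (A B : comUnitRingType) (f : {rmorphism A -> B}) :
  bijective f -> irreducibles_prime B -> irreducibles_prime A.
Proof.
move=> [g fK gK] hB p [p0 pN pP].
have gM : {morph g : x y / x * y}.
  by move=> x y; apply: (can_inj fK); rewrite rmorphM !gK.
have g1 : g 1 = 1 by apply: (can_inj fK); rewrite gK rmorph1.
have gU x : x \is a GRing.unit -> g x \is a GRing.unit.
  move=> xU; apply/unitrP; exists (g x^-1).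
  by rewrite -!gM mulVr // mulrV.
have fU x : f x \is a GRing.unit -> x \is a GRing.unit.
  by move=> /gU; rewrite fK.
have [|_ _ fpP] := hB (f p).
  split.
- by apply: contra p0 => /eqP e; rewrite -(fK p) e -(rmorph0 f) fK.
- by apply: contra pN => /fU.
- move=> q r e; have := pP (g q) (g r).
  rewrite -gM -e fK => /(_ erefl) [/(rmorph_unit f)|/(rmorph_unit f)];
    rewrite gK; by [left|right].
split=> // a b [c e].
have [|[d e']|[d e']] := fpP (f a) (f b).
- by exists (f c); rewrite -!rmorphM e.
- by left; exists (g d); apply: (can_inj fK); rewrite rmorphM gK.
- by right; exists (g d); apply: (can_inj fK); rewrite rmorphM gK.
Qed.

(** If [p] divides [a * b], it divides the product of the leading coefficients, hence one of them;
    subtracting that leading term lowers the sum of the sizes. *)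
Lemma prime_polyC (R : idomainType) (p : R) : prime_elt p -> prime_elt p%:P.
Proof.
move=> [p0 pN pP]; split; first by rewrite polyC_eq0.
  by rewrite poly_unitE size_polyC p0 coefC eqxx.
move=> a b; have [n] := ubnP (size a + size b).
elim: n => // n IH in a b *; rewrite ltnS => sn [c e].
have [->|a0] := eqVneq a 0; first by left; exists 0; rewrite mulr0.
have [->|b0] := eqVneq b 0; first by right; exists 0; rewrite mulr0.
have drop_lead (q : {poly R}) : q != 0 ->
    exists q', q = q' + (lead_coef q)%:P * 'X ^+ (size q).-1 /\ (size q' < size q)%N.
  move=> q0; exists (take_poly (size q).-1 q); split; last first.
    by apply: leq_ltn_trans (size_take_poly _ _) _; rewrite ltn_predL size_poly_gt0.
  rewrite -{1}(poly_take_drop (size q).-1 q); congr (_ + _ * _).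
  apply/polyP => i; rewrite coef_drop_poly coefC lead_coefE.
  by case: i => [//|i]; rewrite /= nth_default //; lia.
have [a' [ea sa]] := drop_lead _ a0; have [b' [eb sb]] := drop_lead _ b0.
have [|[d la]|[d lb]] := pP (lead_coef a) (lead_coef b).
- exists (lead_coef c); rewrite -lead_coefM e lead_coefM lead_coefC //.
- have [||[t e']|] := IH a' b; first lia.
  + exists (c - d%:P * 'X ^+ (size a).-1 * b).
    have -> : a' = a - (p * d)%:P * 'X ^+ (size a).-1 by rewrite -la {1}ea addrK.
    by rewrite (mulrBr p%:P) -e polyCM; ring.
  + left; exists (t + d%:P * 'X ^+ (size a).-1).
    by rewrite {1}ea e' la polyCM; ring.
  + by right.
- have [||//|[t e']] := IH a b'; first lia.
  + exists (c - d%:P * 'X ^+ (size b).-1 * a).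
    have -> : b' = b - (p * d)%:P * 'X ^+ (size b).-1 by rewrite -lb {1}eb addrK.
    by rewrite (mulrBr p%:P) -e polyCM; ring.
  + by left.
  + right; exists (t + d%:P * 'X ^+ (size b).-1).
    by rewrite {1}eb e' lb polyCM; ring.
Qed.

(** * Gauss's lemma for polynomials over a ring with prime factorizations *)

Section Gauss.
Variable R : idomainType.
Hypothesis factR : forall a : R, a != 0 -> prime_factorable a.

(** The primes in [a] stay prime in the polynomial ring, so each divides [q] or [r] and is cancelled
    there; [b] and [c] collect them. *)
Lemma factor_polyC (a : R) (f q r : {poly R}) : a != 0 -> a%:P * f = q * r ->
  exists b c q' r', [/\ q = b%:P * q', r = c%:P * r' & f = q' * r'].
Proof.
move=> /factR [u [s [uU pr ->]]].
elim: s => [|p s IH] in q r pr *.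
  rewrite big_nil mulr1 => e; exists u, 1, (u^-1%:P * q), r.
  rewrite mul1r mulrA -polyCM mulrV // mul1r; split=> //.
  by rewrite -mulrA -e mulrA -polyCM mulVr // mul1r.
have pp : prime_elt p by apply: pr; rewrite mem_head.
have prs x : x \in s -> prime_elt x by move=> xs; apply: pr; rewrite inE xs orbT.
have [pC0 _ pP] := prime_polyC pp.
rewrite big_cons mulrCA polyCM -mulrA => e.
have [|[d ed]|[d ed]] := pP q r; first by eexists; rewrite -e.
- have [|b [c [q' [r' [eq er ef]]]]] := IH d r prs.
    by apply: (mulfI pC0); rewrite e ed mulrA.
  by exists (p * b), c, q', r'; rewrite ed eq polyCM mulrA.
- have [|b [c [q' [r' [eq er ef]]]]] := IH q d prs.
    by apply: (mulfI pC0); rewrite e ed mulrCA.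
  by exists b, (p * c), q', r'; rewrite ed er polyCM mulrA.
Qed.

(** By [factor_polyC], [f] is a constant times a divisor of [g]. One of the two is a unit, and
    [1 < size f] rules out that it is the divisor. *)
Lemma divides_polyC_cancel (a : R) (f g : {poly R}) : irreducible_elt f ->
  (1 < size f)%N -> a != 0 -> divides f (a%:P * g) -> divides f g.
Proof.
move=> [f0 fN fP] sf a0 [h /(factor_polyC a0) [b [c [f' [h' [ef _ ->]]]]]].
have [|/unitrP [v [vf _]]] := fP _ _ ef.
  rewrite poly_unitE coefC /= => /andP [_ bU]; exists (b^-1%:P * h').
  by rewrite ef mulrACA -polyCM mulrV // mul1r.
have f'0 : f' != 0 by apply: contraNneq f0 => e; rewrite ef e mulr0.
have b0 : b != 0 by apply: contraNneq f0 => e; rewrite ef e mul0r.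
have v0 : v != 0.
  by apply: contra_eqN vf => /eqP ->; rewrite mul0r eq_sym oner_eq0.
have /(congr1 (size : {poly R} -> nat)) := vf; rewrite size_mul // size_poly1.
move: sf; rewrite ef size_Cmul // => sf; have := size_poly_gt0 v; rewrite v0; lia.
Qed.

(* With [r] of minimal degree in the ideal [(f, g)], pseudo-division makes [r]
   divide nonzero multiples of [f] and [g] by constants. *)
Lemma irreducibles_prime_poly :
  irreducibles_prime R -> irreducibles_prime {poly R}.
Proof.
move=> primeR f fI; have [f0 fN fP] := fI.
have [sf|sf] := leqP (size f) 1.
  have [a ea] : exists a, f = a%:P by exists f`_0; apply: size1_polyC.
  rewrite ea; apply: prime_polyC; apply: primeR; split.
  - by move: f0; rewrite ea polyC_eq0.
  - by apply: contra fN; rewrite ea => aU; rewrite rmorph_unit.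
  - move=> q r e; have [||] := fP q%:P r%:P; first by rewrite ea e polyCM.
      by rewrite poly_unitE coefC => /andP [_ qU]; left.
    by rewrite poly_unitE coefC => /andP [_ qU]; right.
split=> // g h [k ek].
pose I (r : {poly R}) := exists u v, r = u * f + v * g.
pose Isize n := `[< exists r, [/\ I r, r != 0 & size r = n] >].
have exI : exists n, Isize n.
  exists (size f); apply/asboolP; exists f; split=> //.
  by exists 1, 0; rewrite mul1r mul0r addr0.
case: (ex_minnP exI) => n /asboolP [r [[u [v er]] r0 sr]] rmin.
have pseudo p : I p -> exists a q, a != 0 /\ a%:P * p = q * r.
  move=> [u' [v' ep]].
  exists (lead_coef r ^+ scalp p r), (p %/ r); split.
    by rewrite expf_neq0 // lead_coef_eq0.
  have := Pdiv.Idomain.divp_eq p r.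
  have [->|m0] := eqVneq (p %% r) 0; first by rewrite addr0 mul_polyC.
  rewrite -mul_polyC => e.
  have : Isize (size (p %% r)).
    apply/asboolP; exists (p %% r); split=> //.
    exists ((lead_coef r ^+ scalp p r)%:P * u' - p %/ r * u).
    exists ((lead_coef r ^+ scalp p r)%:P * v' - p %/ r * v).
    move/eqP: e; rewrite addrC -subr_eq => /eqP <-; rewrite ep er; ring.
  by move/rmin; rewrite -sr leqNgt Pdiv.Idomain.ltn_modp r0.
have [|a [q [a0 ea]]] := pseudo f; first by exists 1, 0; rewrite mul1r mul0r addr0.
have [|b [q2 [b0 eb]]] := pseudo g; first by exists 0, 1; rewrite mul1r mul0r add0r.
have [_ [c [q' [r' [_ ec ef]]]]] := factor_polyC a0 ea.
(* If [q'] is a unit, [f] equals [r'] up to a unit, so it divides [r] and hence a constant multiple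
   of [g]. If [r'] is a unit, [r] is a nonzero constant, and multiplying [r = u * f + v * g] by [h]
   shows that [f] divides a constant multiple of [h]. *)
have [q'U|r'U] := fP _ _ ef; [left|right].
  apply: (divides_polyC_cancel fI sf b0); exists (q'^-1 * (q2 * c%:P)).
  rewrite eb ec ef; rewrite mulrACA mulrV // mul1r; ring.
have [w ew] : exists w, r = w%:P.
  exists r`_0; apply: size1_polyC; rewrite ec mul_polyC.
  apply: leq_trans (size_scale_leq _ _) _.
  by move: r'U; rewrite poly_unitE => /andP [/eqP ->].
have w0 : w != 0 by rewrite -polyC_eq0 -ew.
apply: (divides_polyC_cancel fI sf w0); exists (u * h + v * k).
by rewrite -ew er mulrDl -!mulrA ek; ring.
Qed.
End Gauss.

(** * Several variables over a field: irreducible polynomials are prime *)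

(** [msize] is the degree plus one, and 0 for the zero polynomial, so size one singles out the
    nonzero constants. *)
Lemma mpoly_unit_msize (K : fieldType) n (p : {mpoly K[n]}) :
  (p \is a GRing.unit) = (msize p == 1%N).
Proof.
apply/idP/eqP => [/unitrP [q [qp _]]|p1].
  have q0 : q != 0.
    by apply: contra_eqN qp => /eqP ->; rewrite mul0r eq_sym oner_eq0.
  have p0 : p != 0.
    by apply: contra_eqN qp => /eqP ->; rewrite mulr0 eq_sym oner_eq0.
  have /(congr1 (fun p : {mpoly K[n]} => msize p)) := qp; rewrite msizeM // msize1.
  move: q0 p0; rewrite -!msize_poly_eq0.
  move: (msize p) (msize q) => [|a] [|b] //; rewrite addSn addnS /=.
  by move=> _ _ [] /eqP; rewrite addn_eq0 => /andP [_ /eqP ->].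
have e : p = (p@_0)%:MP by apply: msize1_polyC; rewrite p1.
rewrite e rmorph_unit // unitfE; apply: contra_eq_neq p1 => c0.
by rewrite e c0 mpolyC0 msize0.
Qed.

(** A nonzero nonunit that is not irreducible splits into two nonunits of smaller degree, so descent
    on [msize] ends in irreducible factors, which [prK] makes prime. *)
Lemma mpoly_factorable (K : fieldType) n : irreducibles_prime {mpoly K[n]} ->
  forall p : {mpoly K[n]}, p != 0 -> prime_factorable p.
Proof.
move=> prK p; have [m] := ubnP (msize p).
elim: m p => // m IH p; rewrite ltnS => sp p0.
have [pU|pN] := boolP (p \is a GRing.unit).
  by exists p, [::]; split=> //; rewrite big_nil mulr1.
have [pI|pI] := EM (irreducible_elt p).
  exists 1, [:: p]; split; rewrite ?unitr1 ?big_seq1 ?mul1r //.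
  by move=> q; rewrite inE => /eqP ->; apply: prK.
have [q [r [epqr qN rN]]] : exists q r,
    [/\ p = q * r, q \isn't a GRing.unit & r \isn't a GRing.unit].
  apply: contrapT => H; apply: pI; split=> // q r e.
  have [|qN] := boolP (q \is a GRing.unit); first by left.
  have [|rN] := boolP (r \is a GRing.unit); first by right.
  by case: H; exists q, r.
have q0 : q != 0 by apply: contraNneq p0 => e; rewrite epqr e mul0r.
have r0 : r != 0 by apply: contraNneq p0 => e; rewrite epqr e mulr0.
move: qN rN; rewrite !mpoly_unit_msize => qN rN.
move: (q0) (r0) sp; rewrite -!msize_poly_eq0 epqr msizeM // => q1 r1 sp.
have [lq lr] : (msize q < m)%N /\ (msize r < m)%N.
  by move: q1 r1 qN rN sp; move: (msize q) (msize r) => a b; lia.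
have [u [s [uU prs es]]] := IH q lq q0.
have [v [t [vU prt et]]] := IH r lr r0.
exists (u * v), (s ++ t); split; first by rewrite unitrM uU.
  by move=> x; rewrite mem_cat => /orP [/prs|/prt].
by rewrite es et big_cat mulrACA.
Qed.

Lemma muniX (R : comNzRingType) n (m : 'X_{1..n.+1}) :
  muni 'X_[R, m] =
  'X_[[multinom m (widen_ord (leqnSn n) i) | i < n]] *: 'X ^+ (m ord_max).
Proof. by rewrite muniE msuppX big_seq1 mcoeffX eqxx scale1r. Qed.

(** The inverse [g] widens the coefficients and substitutes the last variable for the polynomial
    variable; additivity reduces both identities to single terms. *)
Lemma muni_bij (R : comNzRingType) n : bijective (@muni n R).
Proof.
pose g (q : {poly {mpoly R[n]}}) : {mpoly R[n.+1]} := (mpwiden q).['X_ord_max].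
have gX c k : g (c *: 'X ^+ k) = mwiden c * 'X_ord_max ^+ k.
  by rewrite /g mpwidenZ /mpwiden rmorphXn /= map_polyX !hornerE.
have gD : {morph g : x y / x + y} by move=> x y; rewrite /g rmorphD hornerD.
have g0 : g 0 = 0 by rewrite /g rmorph0 horner0.
have muni_widen (c : {mpoly R[n]}) : muni (mwiden c) = c%:P.
  rewrite (mpolyE c) (big_morph _ (@mwidenD n R) (mwiden0 n R)).
  rewrite (big_morph _ (@muniD n R) (muni0 n R))
    (big_morph _ (@polyCD _) (polyC0 _)).
  apply: eq_bigr => m _; rewrite mwidenZ mwidenX muniZ muniX.
  rewrite mnmwiden_ordmax expr0 -mul_mpolyC polyCM -!mul_polyC mulr1.
  by congr (_ * 'X_[_]%:P); apply/mnmP => i; rewrite mnmE mnmwiden_widen.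
exists g => [p|q].
  rewrite {2}[p]mpolyE muniE (big_morph g gD g0); apply: eq_bigr => m _.
  rewrite gX mwidenZ mwidenX -scalerAl mpolyXn -mpolyXD; congr (_ *: 'X_[_]).
  apply/mnmP => i; rewrite mnmDE mulmnE mnm1E.
  have [->|] := eqVneq i ord_max; first by rewrite mnmwiden_ordmax mul1n.
  case: (unliftP ord_max i) => [j -> _|->]; last by rewrite eqxx.
  have -> : lift ord_max j = widen_ord (leqnSn n) j.
    by apply: val_inj; rewrite /= /bump leqNgt ltn_ord.
  by rewrite mnmwiden_widen mnmE mul0n addn0.
rewrite -[q]coefK poly_def (big_morph g gD g0) rmorph_sum.
apply: eq_bigr => i _; rewrite gX rmorphM rmorphXn /= muni_widen muniX mnm1E eqxx expr1.
rewrite (_ : [multinom _ | _ < _] = 0%MM) ?mpolyX0 ?scale1r ?mul_polyC //.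
by apply/mnmP => j; rewrite mnmE mnm1E mnm0E -val_eqE /= gtn_eqF.
Qed.

(** Induction on the number of variables: without variables every nonzero element is a unit, and
    [muni] makes the next ring a polynomial ring over the previous one, where Gauss's lemma
    applies. *)
Lemma irreducibles_prime_mpoly (K : fieldType) n :
  irreducibles_prime {mpoly K[n]}.
Proof.
elim: n => [|n IH].
  move=> p [p0 /negP[]]; rewrite mpoly_unit_msize.
  have e : p = (p@_0)%:MP.
    apply/mpolyP => m; have -> : m = 0%MM by apply/mnmP => - [].
    by rewrite mcoeffC eqxx mulr1.
  by move: p0; rewrite e msizeC mpolyC_eq0 eqb1.
apply: (@irreducibles_prime_iso _ {poly {mpoly K[n]}} (@muni n K)).
  exact: muni_bij.
apply: irreducibles_prime_poly => //.
exact: mpoly_factorable.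
Qed.

(** * Conditions imposed by points on forms *)

(** For nonzero vectors over a field: they are distinct points of projective space. *)
Definition nonproportional (K : comNzRingType) n (x y : 'I_n -> K) : Prop :=
  exists a b, x a * y b != x b * y a.

(** Comparing the parts of degree [d + e] in [q = p * c] and cancelling [p] shows that [c] equals
    its part of degree [e]. *)
Lemma dhomog_cofactor (K : fieldType) n d e (p q c : {mpoly K[n]}) :
  p != 0 -> p \is d.-homog -> q \is (d + e)%N.-homog -> q = p * c ->
  c \is e.-homog.
Proof.
move=> p0 hp hq qpc; rewrite homog_piE; apply/eqP; apply: (mulfI p0).
rewrite -qpc -[RHS](pihomog_dE hq) {}qpc.
(* The bound is enlarged so that the partition of [c] has a term of degree [e] even when [c] has
   lower degree. *)
have sc : (msize c <= maxn (msize c) e.+1)%N := leq_maxl _ _.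
rewrite [in RHS](pihomog_partitionE sc) [in RHS]mulr_sumr [RHS]raddf_sum /=.
have le : (e < maxn (msize c) e.+1)%N := leq_maxr _ _.
rewrite (bigD1 (Ordinal le)) //= big1 => [|i ie].
  by rewrite addr0 [RHS]pihomog_dE // dhomogM // pihomogP.
apply: (@pihomog_ne0 _ _ _ (d + i)%N); last by rewrite dhomogM // pihomogP.
by rewrite eqn_add2l; apply: contraNneq ie => e'; apply/eqP/val_inj.
Qed.

Lemma dhomog_prod_linear (R : comNzRingType) n (I : Type) (r : seq I)
    (P : pred I) (L : I -> {mpoly R[n]}) :
  (forall j, L j \is 1.-homog) ->
  \prod_(j <- r | P j) L j \is (count P r).-homog.
Proof.
move=> hL; elim: r => [|j r IH]; first by rewrite big_nil dhomog1.
rewrite big_cons /=; case: (P j) => //.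
exact: dhomogM (hL j) IH.
Qed.

(** For each other point [x j], a minor of the variables against [x j] is a linear form that
    vanishes there but not at [x i]. The product of these has degree [m.-1]; a power of a coordinate
    nonzero at [x i] raises it to [N]. *)
Lemma separating_form (K : fieldType) n m (x : 'I_m -> 'I_n -> K) (N : nat)
    (i : 'I_m) :
  (m <= N)%N ->
  (exists a, x i a != 0) ->
  (forall j, i != j -> nonproportional (x i) (x j)) ->
  exists p : dhomog n K N, (p : {mpoly K[n]}).@[x i] != 0 /\
    forall j, i != j -> (p : {mpoly K[n]}).@[x j] = 0.
Proof.
move=> mN [a xa] npx.
have lin j : {L : {mpoly K[n]} | L \is 1.-homog /\
    (i != j -> L.@[x i] != 0 /\ L.@[x j] = 0)}.
  (* The default form 0 at [j = i] is left out of the product [P]. *)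
  apply: cid; have [<-|ij] := eqVneq i j; first by exists 0; rewrite rpred0.
  have [b [c bc]] := npx j ij.
  exists (x j c *: 'X_b - x j b *: 'X_c); split.
    by rewrite rpredB // rpredZ // dhomogX; apply/eqP; apply: mdeg1.
  move=> _; rewrite !mevalB !mevalZ !mevalXU subr_eq0 mulrC [x j b * _]mulrC.
  by split=> //; apply/eqP; rewrite subr_eq0 mulrC.
pose L j := sval (lin j).
pose P := 'X_a ^+ (N - m.-1) * \prod_(j | i != j) L j.
have hP : P \is N.-homog.
  have m0 : (0 < m)%N := leq_ltn_trans (leq0n _) (ltn_ord i).
  have -> : N = (1 * (N - m.-1) + m.-1)%N by lia.
  apply: dhomogM.
    by apply: dhomogMn; rewrite dhomogX; apply/eqP; apply: mdeg1.
  have -> : m.-1 = count (fun j => i != j) (index_enum 'I_m).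
    rewrite -[in LHS](card_ord m) -(cardC1 i) cardE -size_filter /enum_mem.
    by congr (size _); apply: eq_filter => j; rewrite !inE eq_sym.
  by apply: dhomog_prod_linear => j; have [] := svalP (lin j).
exists (DHomog hP); split=> [|j ij] /=.
  rewrite mevalM rmorphXn /= mevalXU mulf_neq0 ?expf_neq0 //.
  rewrite rmorph_prod; apply/prodf_neq0 => j ij.
  by have [_ /(_ ij) []] := svalP (lin j).
rewrite mevalM rmorph_prod /= (bigD1 j) //=.
by have [_ /(_ ij) [_ ->]] := svalP (lin j); rewrite mul0r mulr0.
Qed.

Lemma dim_dhomog (K : fieldType) n d : \dim {: dhomog n.+1 K d} = 'C(d + n, d).
Proof. by rewrite dimvf. Qed.

Section Evaluation.
Variables (K : fieldType) (n m N : nat) (x : 'I_m -> 'I_n.+1 -> K).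

Definition evaluations (p : dhomog n.+1 K N) : 'rV[K]_m :=
  \row_i (p : {mpoly K[n.+1]}).@[x i].

Lemma evaluations_is_linear : linear evaluations.
Proof. by move=> c p q; apply/rowP => i; rewrite !mxE /= mevalD mevalZ. Qed.

HB.instance Definition _ := GRing.isLinear.Build K (dhomog n.+1 K N) 'rV[K]_m _
  evaluations evaluations_is_linear.

(** The separating forms make [evaluations] surjective, so its kernel, which contains [W], has
    codimension [m]. *)
Lemma points_independent (W : {vspace dhomog n.+1 K N}) :
  (m <= N)%N -> (forall i, exists a, x i a != 0) ->
  (forall i j, i != j -> nonproportional (x i) (x j)) ->
  (forall p, p \in W -> forall i, (p : {mpoly K[n.+1]}).@[x i] = 0) ->
  (m + \dim W <= 'C(N + n, N))%N.
Proof.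
move=> mN x0 npx Wx.
have := limg_ker_dim (linfun evaluations) fullv.
rewrite capfv.
have -> : (limg (linfun evaluations) = fullv)%VS.
  apply/eqP; rewrite eqEsubv subvf; apply/subvP => v _.
  rewrite [v]row_sum_delta; apply: rpred_sum => i _; apply: rpredZ.
  have [p [pi pj]] := separating_form mN (x0 i) (npx i).
  apply/memv_imgP; exists ((p : {mpoly K[n.+1]}).@[x i]^-1 *: p).
    exact: memvf.
  apply/rowP => j; rewrite lfunE /= !mxE mevalZ eqxx /= eq_sym.
  by have [<-|/pj ->] := eqVneq i j; rewrite ?mulVf ?mulr0.
rewrite dim_dhomog dimvf dim_matrix [(_ * m)%R]mul1n => <-.
rewrite addnC leq_add2r; apply: dimvS.
apply/subvP => p pW; rewrite memv_ker lfunE; apply/eqP/rowP => i.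
by rewrite !mxE Wx.
Qed.
End Evaluation.

(** * Bezout bound for two forms of the same degree *)

Section Multiplication.
Variables (K : fieldType) (n d e : nat) (F : dhomog n.+1 K d).

Definition hmul (p : dhomog n.+1 K e) : dhomog n.+1 K (d + e) :=
  DHomog (dhomogM (dhomog_is_dhomog F) (dhomog_is_dhomog p)).

Lemma hmul_is_linear : linear hmul.
Proof. by move=> c p q; apply: val_inj; rewrite /= mulrDr scalerAr. Qed.

HB.instance Definition _ := GRing.isLinear.Build K (dhomog n.+1 K e)
  (dhomog n.+1 K (d + e)) _ hmul hmul_is_linear.

Lemma hmul_lker0 : F != 0 -> lker (linfun hmul) == 0%VS.
Proof.
move=> F0; apply/lker0P => p q; rewrite !lfunE => /(congr1 val) /= e'.
by apply: val_inj; apply: (mulfI _ e').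
Qed.
End Multiplication.

Lemma bin_add2 k : ('C(k + 2, k) * 2 = (k + 2) * (k + 1))%N.
Proof.
have := bin_ffact (k + 2) 2; rewrite -bin_sub ?leq_addl // addnK => ->.
by rewrite addn2 addn1 !ffactSS ffactn0 muln1.
Qed.

(* Bezout by counting dimensions: in degree [2 * d + m] the ideal [(F, G)]
   has codimension at most [d ^ 2], because [F p = G q] forces [F] to divide
   [q], while the [m] points impose independent conditions. *)
Lemma common_zeros_le (K : fieldType) d m (x : 'I_m -> 'I_3 -> K)
    (F G : {mpoly K[3]}) :
  irreducible_elt F -> F \is d.-homog -> G \is d.-homog -> ~ divides F G ->
  (forall i, exists a, x i a != 0) ->
  (forall i j, i != j -> nonproportional (x i) (x j)) ->
  (forall i, F.@[x i] = 0) -> (forall i, G.@[x i] = 0) ->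
  (m <= d ^ 2)%N.
Proof.
move=> FI hF hG FG x0 npx Fx Gx.
have [F0 _ Fprime] := irreducibles_prime_mpoly FI.
have G0 : G != 0 by apply/eqP => e; apply: FG; exists 0; rewrite mulr0.
pose f := DHomog hF; pose g := DHomog hG.
have f0 : f != 0 by [].
have g0 : g != 0 by [].
pose mf := linfun (@hmul K 2 d (d + m) f).
pose mg := linfun (@hmul K 2 d (d + m) g).
(* Multiples of [F * G]; they will contain every common multiple of [F] and [G] in degree
   [2 * d + m]. *)
pose mfg := (mf \o linfun (@hmul K 2 d m g))%VF.
pose W := (limg mf + limg mg)%VS.
have dimW := dimv_sum_cap (limg mf) (limg mg).
have kf : (fullv :&: lker mf = 0)%VS by rewrite (eqP (hmul_lker0 _ f0)) capv0.
have kg : (fullv :&: lker mg = 0)%VS by rewrite (eqP (hmul_lker0 _ g0)) capv0.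
rewrite (limg_dim_eq kf) (limg_dim_eq kg) dim_dhomog in dimW.
have sub : (limg mf :&: limg mg <= limg mfg)%VS.
  apply/subvP => _ /memv_capP [/memv_imgP [p _ ->] /memv_imgP [q _]].
  rewrite !lfunE => /(congr1 val) /= e.
  have [|/FG //|[c ec]] := Fprime G (val q); first by exists (val p).
  have hc : c \is m.-homog.
    exact: dhomog_cofactor F0 hF (dhomog_is_dhomog q) ec.
  apply/memv_imgP; exists (DHomog hc); first exact: memvf.
  by rewrite /mfg comp_lfunE !lfunE; apply: val_inj; rewrite /= e ec mulrCA.
have dimI : (\dim (limg mf :&: limg mg) <= 'C(m + 2, m))%N.
  apply: leq_trans (dimvS sub) _.
  by rewrite -(dim_dhomog K) -(limg_ker_dim mfg fullv) leq_addl.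
(* The degree [2 * d + m] is at least [m], as the independence of the points requires. *)
have : (m + \dim W <= 'C(d + (d + m) + 2, d + (d + m)))%N.
  apply: (points_independent _ x0 npx); first by lia.
  move=> _ /memv_addP [_ /memv_imgP [p _ ->] [_ /memv_imgP [q _ ->] ->]] i.
  by rewrite !lfunE /= mevalD !mevalM Fx Gx !mul0r addr0.
rewrite -/W in dimW; move: dimW dimI.
(* The second difference with step [d] of the quadratic [(t + 2) * (t + 1) / 2] is [d ^ 2]. *)
have := bin_add2 m; have := bin_add2 (d + m); have := bin_add2 (d + (d + m)).
move: 'C(_, _) => a; move: 'C(_, _) => b; move: 'C(_, _) => c.
nia.
Qed.

(** * Primitive integer points and a determinant bound *)

(** If all minors vanish, multiplying entries of one vector by the gcd of the other gives equal
    absolute values, as both gcds are 1. The sign convention then makes the first nonzero entries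
    equal, and proportionality the rest. *)
Lemma Z3_nonproportional (x y : 'rV[int]_3) : Z3 x -> Z3 y -> x != y ->
  nonproportional (fun i => (x ord0 i)%:~R : rat) (fun i => (y ord0 i)%:~R).
Proof.
move=> [_ gx [i [xi0 xi]]] [_ gy [j [yj0 yj]]]; apply: contra_neqP => npxy.
have xy a b : x ord0 a * y ord0 b = x ord0 b * y ord0 a.
  apply/eqP; rewrite -(eqr_int rat) !rmorphM /=; apply/negPn/negP => ab.
  by apply: npxy; exists a, b.
have gcdM (k : nat) (f : 'I_3 -> nat) :
    (k * \big[gcdn/0%N]_i f i)%N = \big[gcdn/0%N]_i (k * f i)%N.
  by rewrite (big_morph (muln k) (muln_gcdr k) (muln0 k)).
have absE b : `|x ord0 b|%N = `|y ord0 b|%N.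
  suff : (`|x ord0 b| * vec_gcd y = `|y ord0 b| * vec_gcd x)%N.
    by rewrite gx gy !muln1.
  by rewrite /vec_gcd !gcdM; apply: eq_bigr => a _; rewrite -!abszM -xy mulrC.
have yi : y ord0 i = x ord0 i.
  have [ij|ij|ij] := ltngtP i j.
  - by move: (absE i) xi0; rewrite (yj _ ij) => /eqP; rewrite absz_eq0 => /eqP ->.
  - by move: (absE j) yj0; rewrite (xi _ ij) => /esym/eqP; rewrite absz_eq0 => /eqP ->.
  - have {}ij : i = j by apply: val_inj.
    by have := absE i; rewrite -ij in yj0; lia.
apply/rowP => b; apply: (mulfI (lt0r_neq0 xi0)).
by rewrite -{1}yi mulrC xy.
Qed.

(** Leibniz expansion: [n!] terms, each a signed product of [n] entries. *)
Lemma det_le (R : numDomainType) n (A : 'M[R]_n) (M : R) :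
  (forall i j, `|A i j| <= M) -> `|\det A| <= n`!%:R * M ^+ n.
Proof.
move=> AM; apply: le_trans (ler_norm_sum _ _ _) _.
apply: le_trans (_ : \sum_(s : 'S_n) M ^+ n <= _).
  apply: ler_sum => s _; rewrite normrM normrX normrN1 expr1n mul1r.
  rewrite normr_prod -[in M ^+ _](card_ord n) -prodr_const.
  by apply: ler_prod => i _; rewrite normr_ge0 AM.
by rewrite sumr_const card_Sn mulr_natl.
Qed.

(** * Coordinates of forms in the monomial basis *)

(** Numbers the monomials of degree [d], which [basis] lists as tuples of variable indices. The
    default [0%MM] is never reached, as the list has length ['C(d + n, d)]. *)
Definition monomial n d (j : 'I_('C(d + n, d))) : 'X_{1..n.+1} :=
  nth 0%MM [seq s2m t | t : d.-tuple 'I_n.+1 <- enum (basis n.+1 d)] j.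

Lemma mdeg_monomial n d (j : 'I_('C(d + n, d))) : mdeg (monomial j) = d.
Proof. by apply/eqP; rewrite basis_cover mem_nth // size_basis. Qed.

Lemma monomial_inj n d : injective (@monomial n d).
Proof.
move=> i j /eqP; rewrite nth_uniq ?size_basis ?uniq_basis //.
by move=> /eqP/val_inj.
Qed.

Lemma monomialP n d (m : 'X_{1..n.+1}) : mdeg m = d ->
  exists j : 'I_('C(d + n, d)), m = monomial j.
Proof.
move/eqP; rewrite basis_cover => /(nthP 0%MM) [j]; rewrite size_basis => lj <-.
by exists (Ordinal lj).
Qed.

Lemma mcoeff_sum_monomial (R : comNzRingType) n d (c : 'I_('C(d + n, d)) -> R)
    j :
  (\sum_i c i *: 'X_[monomial i])@_(monomial j) = c j.
Proof.
rewrite raddf_sum /= (bigD1 j) //= mcoeffZ mcoeffX eqxx mulr1.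
rewrite big1 ?addr0 // => i ij; rewrite mcoeffZ mcoeffX.
by rewrite (inj_eq (@monomial_inj n d)) (negbTE ij) mulr0.
Qed.

Lemma dhomog_sum_monomial (R : comNzRingType) n d (c : 'I_('C(d + n, d)) -> R) :
  \sum_i c i *: 'X_[monomial i] \is d.-homog.
Proof.
apply: rpred_sum => i _; apply: rpredZ; rewrite dhomogX.
by apply/eqP; apply: mdeg_monomial.
Qed.

Lemma dhomog_monomialE (R : comNzRingType) n d (F : {mpoly R[n.+1]}) :
  F \is d.-homog ->
  F = \sum_(j < 'C(d + n, d)) F@_(monomial j) *: 'X_[monomial j].
Proof.
move=> hF; apply/mpolyP => m; have [/eqP md|md] := boolP (mdeg m == d).
  have [j ->] := monomialP md.
  exact: esym (mcoeff_sum_monomial (fun i => F@_(monomial i)) j).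
by rewrite !(dhomog_nemf_coeff _ md) ?dhomog_sum_monomial.
Qed.

Lemma meval_sum_monomial (R : comNzRingType) n d (c : 'I_('C(d + n, d)) -> R)
    v :
  (\sum_j c j *: 'X_[monomial j]).@[v] =
  \sum_j c j * \prod_i v i ^+ monomial j i.
Proof.
by rewrite raddf_sum; apply: eq_bigr => j _; rewrite /= mevalZ mevalX.
Qed.

(** * Evaluation matrix and the height bound *)

(** With coprime coefficients [c m], the conclusion becomes that [a] divides [D]. *)
Lemma gcd_dvdn (T : Type) (s : seq T) (c : T -> nat) (a D : nat) :
  (forall m, a %| D * c m)%N -> (a %| D * \big[gcdn/0%N]_(m <- s) c m)%N.
Proof.
move=> ac; elim: s => [|m s IH]; first by rewrite big_nil muln0.
by rewrite big_cons muln_gcdr dvdn_gcd ac.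
Qed.

(* The unit vector [e_k] in row [ord0] excludes the multiples of [F] from the
   kernel. *)
Definition evaluation_matrix (m d : nat) (x : 'I_m -> 'rV[int]_3)
    (k : 'I_('C(d + 2, d))) : 'M[int]_(m.+1, 'C(d + 2, d)) :=
  \matrix_(i, j) if unlift ord0 i is Some i'
                 then \prod_l x i' ord0 l ^+ monomial j l else (j == k)%:R.

Section Height.
Variables (d m : nat) (F : {mpoly int[3]}) (x : 'I_m -> 'rV[int]_3).
Hypothesis hF : F \is d.-homog.
Hypothesis FI : irreducible_over_Q F.
Hypothesis x3 : forall i, Z3 (x i).
Hypothesis x_inj : injective x.
Hypothesis Fx : forall i, F.@[x i ord0] = 0.
Hypothesis m_gt : (d ^ 2 < m)%N.

Let N := 'C(d + 2, d).

(** A kernel vector gives a form [G] vanishing at more than [d ^ 2] points, so [common_zeros_le]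
    makes it a multiple of [F], and the row [e_k] leaves only zero. *)
Lemma evaluation_matrix_full (k : 'I_N) : F@_(monomial k) != 0 ->
  row_full (map_mx (intr : int -> rat) (evaluation_matrix x k)).
Proof.
move=> Fk.
pose FQ := map_mpoly (intr : int -> rat) F.
pose xq i l : rat := (x i ord0 l)%:~R.
have FQj (j : 'I_N) : FQ@_(monomial j) = (F@_(monomial j))%:~R.
  by rewrite mcoeff_map_mpoly.
have hFQ : FQ \is d.-homog.
  apply/dhomogP => mm; rewrite mcoeff_msupp mcoeff_map_mpoly intr_eq0.
  by rewrite -mcoeff_msupp; exact: (dhomog_mf hF).
have FQx i : FQ.@[xq i] = 0.
  have := Fx i; rewrite (dhomog_monomialE hF) (dhomog_monomialE hFQ).
  rewrite !meval_sum_monomial.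
  move/(congr1 (intr : int -> rat)); rewrite rmorph_sum rmorph0 /= => e.
  rewrite -[RHS]e; apply: eq_bigr => j _; rewrite FQj rmorphM rmorph_prod /=.
  by congr (_ * _); apply: eq_bigr => l _; rewrite rmorphXn.
rewrite /row_full -mxrank_tr -/(row_free _); apply: inj_row_free => v vB.
pose G := \sum_j v ord0 j *: 'X_[monomial j] : {mpoly rat[3]}.
have hG : G \is d.-homog by apply: dhomog_sum_monomial.
have Gx i : G.@[xq i] = 0.
  have /rowP/(_ (lift ord0 i)) := vB; rewrite !mxE /G meval_sum_monomial => e.
  rewrite -[RHS]e; apply: eq_bigr => j _; rewrite !mxE liftK rmorph_prod /=.
  by congr (_ * _); apply: eq_bigr => l _; rewrite rmorphXn.
have Gk : v ord0 k = 0.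
  have /rowP/(_ ord0) := vB; rewrite !mxE (bigD1 k) //= !mxE.
  rewrite unlift_none eqxx mulr1.
  by rewrite big1 ?addr0 // => j jk; rewrite !mxE unlift_none (negbTE jk) mulr0.
have [[c Gc]|FG] := EM (divides FQ G); last first.
  suff : (m <= d ^ 2)%N by rewrite leqNgt m_gt.
  apply: (common_zeros_le (x := xq) FI hFQ hG FG) => // [i|i j ij].
    have [_ _ [a [xa _]]] := x3 i; exists a.
    by rewrite intr_eq0 lt0r_neq0.
  by apply: Z3_nonproportional => //; rewrite (inj_eq x_inj).
have FQ0 : FQ != 0 by case: FI.
(* Equal degrees make the cofactor a scalar; the coefficient of [G] at [k] vanishes and that of [F]
   does not, so this scalar is 0. *)
have hc : c \is 0.-homog.
  by apply: (@dhomog_cofactor _ _ d 0 FQ G c) => //; rewrite addn0.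
have ec : c = (c@_0)%:MP.
  apply/mpolyP => mm; rewrite mcoeffC.
  have [->|m0] := eqVneq mm 0%MM; first by rewrite mulr1.
  by rewrite mulr0 (dhomog_nemf_coeff hc) // mdeg_eq0.
have Gj j : v ord0 j = (F@_(monomial j))%:~R * c@_0.
  rewrite -FQj -(@mcoeff_sum_monomial _ 2 d (fun i => v ord0 i)) -/G.
  by rewrite Gc {1}ec mulrC mcoeffCM mulrC.
have c0 : c@_0 = 0.
  by apply/eqP; have /eqP := Gk; rewrite Gj mulf_eq0 intr_eq0 (negbTE Fk).
by apply/rowP => j; rewrite Gj c0 mulr0 mxE.
Qed.

(** The rows of points give the values of [F], which vanish, and the row [e_k] gives the coefficient
    at [k]; so [w] is a unit vector. *)
Lemma evaluation_matrix_mul (k : 'I_N) :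
  exists w,
    evaluation_matrix x k *m (\col_j F@_(monomial j)) = F@_(monomial k) *: w.
Proof.
exists (\col_i (i == ord0)%:R); apply/colP => i; rewrite !mxE.
case: (unliftP ord0 i) => [i' ->|->].
  rewrite eq_sym (negbTE (neq_lift _ _)) mulr0 -[RHS](Fx i').
  rewrite [in RHS](dhomog_monomialE hF) meval_sum_monomial.
  by apply: eq_bigr => j _; rewrite !mxE liftK mulrC.
rewrite eqxx mulr1 (bigD1 k) //= !mxE unlift_none eqxx mul1r.
by rewrite big1 ?addr0 // => j jk; rewrite !mxE unlift_none (negbTE jk) mul0r.
Qed.

Lemma height_le (R : realType) (B : R) : 1 <= B ->
  (forall i, (vec_height (x i))%:R <= B) -> coef_gcd F = 1%N ->
  (coef_height F)%:R <= N`!%:R * B ^+ (d * N).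
Proof.
move=> B1 xB gF.
have F0 : F != 0.
  apply: contraPneq FI => ->.
  by rewrite /irreducible_over_Q raddf0 => - []; rewrite eqxx.
have suppF mm : mm \in msupp F -> exists j : 'I_N, mm = monomial j.
  by move=> ms; apply: monomialP; apply: (dhomog_mf hF).
have [j0 Fj0] : exists j0 : 'I_N, F@_(monomial j0) != 0.
  have := mlead_supp F0 => ms; have [j ej] := suppF _ ms.
  by exists j; rewrite -ej -mcoeff_msupp.
pose k := [arg max_(i > j0) `|F@_(monomial i)|%N].
have kmax (j : 'I_N) : (`|F@_(monomial j)| <= `|F@_(monomial k)|)%N.
  by rewrite /k; case: arg_maxnP => // i _ /(_ j isT).
have hk : (coef_height F <= `|F@_(monomial k)|)%N.
  by apply/bigmax_leqP_seq => mm /suppF [j ->] _.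
have Fk : F@_(monomial k) != 0.
  by rewrite -absz_gt0; apply: leq_trans (kmax j0); rewrite absz_gt0.
have full := evaluation_matrix_full Fk.
pose A := rowsub (fullrankfun full) (evaluation_matrix x k).
have D0 : \det A != 0.
  rewrite -(intr_eq0 rat) -det_map_mx map_mxsub -unitfE -unitmxE.
  exact: fullrowsub_unit.
have dvdD : (`|F@_(monomial k)| %| `|\det A|)%N.
  suff : (`|F@_(monomial k)| %| `|\det A| * coef_gcd F)%N by rewrite gF muln1.
  apply: gcd_dvdn => mm.
  have [ms|] := boolP (mm \in msupp F); last first.
    by move/memN_msupp_eq0 ->; rewrite muln0 dvdn0.
  have [j ->] := suppF _ ms.
  have [w ew] := evaluation_matrix_mul k.
  have : \adj A *m (A *m (\col_j F@_(monomial j))) =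
      F@_(monomial k) *: (\adj A *m rowsub (fullrankfun full) w).
    rewrite /A mul_rowsub_mx ew scalemxAr; congr (_ *m _).
    by apply/matrixP => i i'; rewrite !mxE.
  rewrite mulmxA mul_adj_mx mul_scalar_mx => /colP /(_ j).
  by rewrite !mxE -abszM => ->; rewrite abszM dvdn_mulr.
have lekD : (`|F@_(monomial k)| <= `|\det A|)%N.
  by apply: dvdn_leq => //; rewrite absz_gt0.
apply: le_trans (_ : `|\det A|%N%:R <= _).
  by rewrite ler_nat (leq_trans hk).
have -> : (`|\det A|%N%:R : R) = `|\det (map_mx intr A)|.
  by rewrite det_map_mx -intr_norm -abszE.
have B0 : 0 <= B := le_trans ler01 B1.
(* Every entry is at most [B ^+ d]: a monomial of degree [d] at a point of height at most [B], or 0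
   or 1 in the row [e_k], where [1 <= B] enters. *)
rewrite exprM; apply: det_le => i j; rewrite !mxE.
case: (unlift _ _) => [l|]; last first.
  by case: (j == k); rewrite ?normr0 ?normr1 ?exprn_ege1 ?exprn_ge0.
rewrite rmorph_prod normr_prod -[X in B ^+ X](mdeg_monomial j) mdegE -prodrXr.
apply: ler_prod => a _; rewrite normr_ge0 /= rmorphXn normrX lerXn2r ?nnegrE //.
apply: le_trans (xB l); rewrite -intr_norm -abszE ler_nat.
exact: (@leq_bigmax _ (fun i => `|x l ord0 i|%N)).
Qed.
End Height.

(** * The dichotomy between few zeros and small height *)

(** [(d + 1) * (d + 2)] is twice the binomial coefficient, so the truncated division is exact. *)
Lemma bin_add2_exponent d : (d * 'C(d + 2, d) = (d * (d + 1) * (d + 2)) %/ 2)%N.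
Proof. by rewrite -mulnA [((d + 1) * _)%N]mulnC -bin_add2 mulnA mulnK. Qed.

Unset Implicit Arguments.

Theorem theorem4 (R : realType) (d : nat) (hd : (1 <= d)%N) :
  exists c : R,
    forall (F : {mpoly int[3]}) (B : R),
      F \is d.-homog ->
      irreducible_over_Q F ->
      coef_gcd F = 1%N ->
      1 <= B ->
      (Ncount F B <= d ^ 2)%N \/
      (coef_height F)%:R <= c * B ^+ ((d * (d + 1) * (d + 2)) %/ 2).
Proof.
(* The factorial is the number of terms in the determinant. *)
exists (('C(d + 2, d))`!%:R) => F B hF FI gF B1.
have [|Ngt] := leqP (Ncount F B) (d ^ 2); [by left|right].
rewrite -bin_add2_exponent.
pose x (i : 'I_(Ncount F B)) : 'rV[int]_3 := nth 0 (fset_set (zeros F B)) i.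
have xZ i : zeros F B (x i).
  have : x i \in fset_set (zeros F B) by apply: mem_nth.
  by rewrite in_fset_set ?inE //; apply: finite_zeros.
apply: (@height_le d _ F x) => //.
- by move=> i; case: (xZ i).
- by move=> i j /eqP; rewrite nth_uniq ?fset_uniq // => /eqP/val_inj.
- by move=> i; case: (xZ i).
- by move=> i; case: (xZ i).
Qed.
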